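(* Let $M$ be a tangent developable spacelike surface in $\mathbf{E}_1^3$ generated by a curve $\gamma$. Then $M$ is a constant angle surface if and only if $\gamma$ is a helix with $\tau^2<\kappa^2$. Moreover, the direction $U$ with which $M$ makes a constant hyperbolic angle $\theta$ is given by $$U=\frac{1}{\sqrt{\kappa^2-\tau^2}}\Big(-\tau(s)\,\mathbf{T}(s)+\kappa(s)\,\mathbf{B}(s)\Big)$$ and the angle $\theta$ is determined by the relation $$\cosh(\theta)=\frac{\kappa}{\sqrt{\kappa^2-\tau^2}}.$$
   Context: $\mathbf{E}_1^3$ is $\mathbb{R}^3$ with the Lorentzian metric $\langle\,,\rangle=dx_1^2+dx_2^2-dx_3^2$. A vector $w$ is spacelike if $\langle w,w\rangle>0$ or $w=0$, timelike if $\langle w,w\rangle<0$; $|w|=\sqrt{|\langle w,w\rangle|}$. For timelike $a,b$ in the same timelike cone ($\langle a,b\rangle<0$) the hyperbolic angle is the unique $\theta\ge 0$ with $\langle a,b\rangle=-|a||b|\cosh\theta$. The Lorentzian cross product is defined by $\langle u\times v,w\rangle=\det(u,v,w)$. A smooth immersion of a connected surface is spacelike if the induced metric is Riemannian; equivalently its unit normal fields are timelike. It is a constant angle surface if there is a fixed timelike vector $U$ such that a unit normal field $\xi$, with its sign chosen so that it lies in the same timelike cone as $U$, makes a constant hyperbolic angle with $U$ (equivalently $\langle\xi,U\rangle$ is constant). The tangent developable surface generated by a regular curve $\gamma:I\to\mathbf{E}_1^3$ ($I$ an interval) is $x(s,t)=\gamma(s)+t\gamma'(s)$, considered for $t>0$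 and where it is regular, i.e. $\gamma'(s)\times\gamma''(s)\ne0$. Since $M$ is spacelike, $\gamma$ is spacelike, and it is parametrized by arc length, $\langle\gamma',\gamma'\rangle=1$; spacelikeness of $M$ is then equivalent to $\langle\gamma'',\gamma''\rangle>0$. Put $\mathbf{T}=\gamma'$, $\kappa=|\gamma''|>0$ (curvature), $\mathbf{N}=\gamma''/\kappa$, $\mathbf{B}=\mathbf{T}\times\mathbf{N}$ (a unit timelike vector), $\tau=-\langle\mathbf{N}',\mathbf{B}\rangle$ (torsion). The Frenet equations are $\mathbf{T}'=\kappa\mathbf{N}$, $\mathbf{N}'=-\kappa\mathbf{T}+\tau\mathbf{B}$, $\mathbf{B}'=\tau\mathbf{N}$. The curve $\gamma$ is a helix if there is a nonzero vector $v\in\mathbf{E}_1^3$ such that $\langle\gamma'(s),v\rangle$ is constant; equivalently, $\tau/\kappa$ is constant.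
   Formalization: That U and θ must be as displayed is claimed, up to a nonzero multiple of U, only when τ is not identically 0; if τ=0 everywhere, M is planar and every timelike U makes a constant angle with it, and only existence of the displayed U and θ is claimed. *)

(* Defs.v *)
From mathcomp Require Import all_boot all_order all_algebra.
From mathcomp Require Import all_classical all_reals all_analysis.
From mathcomp Require Import ring.

Set Implicit Arguments.
Unset Strict Implicit.
Unset Printing Implicit Defensive.

Import Order.TTheory GRing.Theory Num.Theory.
Import numFieldNormedType.Exports.

Local Open Scope classical_set_scope.
Local Open Scope ring_scope.

Section Minkowski.
Variable R : realType.
Implicit Types u v w a b U : 'rV[R]_3.

(* The space 'rV[R]_3 carries its library topology only; `|u| is its sup norm
   and is unrelated to the Lorentzian length [llen]. *)
Definition linner u v : R :=
  u 0 0 * v 0 0 + u 0 1 * v 0 1 - u 0 2 * v 0 2.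

Definition timelike w : Prop := linner w w < 0.

Definition llen w : R := Num.sqrt `|linner w w|.

(* The defining property <u x v, w> = det(u, v, w) is [lcrossE]; the last
   coordinate has the opposite of its Euclidean sign. *)
Definition lcross u v : 'rV[R]_3 :=
  \row_(j < 3)
    if j == 0 then u 0 1 * v 0 2 - u 0 2 * v 0 1
    else if j == 1 then u 0 2 * v 0 0 - u 0 0 * v 0 2
    else u 0 1 * v 0 0 - u 0 0 * v 0 1.

Lemma lcrossE u v w :
  linner (lcross u v) w = \det (col_mx u (col_mx v w) : 'M[R]_3).
Proof.
set A := (X in \det X).
have A0 j : A 0 j = u 0 j.
  by rewrite (_ : 0 = lshift 2 (0 : 'I_1)) ?col_mxEu //; exact: val_inj.
have A1 j : A 1 j = v 0 j.
  rewrite (_ : 1 = rshift 1 (lshift 1 (0 : 'I_1))) ?col_mxEd ?col_mxEu //.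
  exact: val_inj.
have A2 j : A 2 j = w 0 j.
  rewrite (_ : 2 = rshift 1 (rshift 1 (0 : 'I_1))) ?col_mxEd //.
  exact: val_inj.
clearbody A.
have l0 : lift 0 (0 : 'I_2) = 1 :> 'I_3 by exact: val_inj.
have l1 : lift 0 (1 : 'I_2) = 2 :> 'I_3 by exact: val_inj.
have m0 : lift 1 (0 : 'I_2) = 0 :> 'I_3 by exact: val_inj.
have m1 : lift 1 (1 : 'I_2) = 2 :> 'I_3 by exact: val_inj.
have n0 : lift 2 (0 : 'I_2) = 0 :> 'I_3 by exact: val_inj.
have n1 : lift 2 (1 : 'I_2) = 1 :> 'I_3 by exact: val_inj.
have det2 (C : 'M[R]_2) : \det C = C 0 0 * C 1 1 - C 0 1 * C 1 0.
  rewrite (expand_det_row _ 0) 2!big_ord_recl big_ord0.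
  rewrite (_ : lift 0 0 = 1 :> 'I_2); last exact: val_inj.
  rewrite /cofactor !det_mx11 !mxE.
  rewrite (_ : lift 0 0 = 1 :> 'I_2); last exact: val_inj.
  rewrite (_ : lift 1 0 = 0 :> 'I_2); last exact: val_inj.
  by rewrite /=; ring.
rewrite (expand_det_row _ 0) 3!big_ord_recl big_ord0.
rewrite (_ : lift 0 (lift 0 0) = 2); last exact: val_inj.
rewrite (_ : lift 0 0 = 1 :> 'I_3); last exact: val_inj.
rewrite /cofactor !det2 !mxE !l0 !l1 !m0 !m1 !n0 !n1 !A0 !A1 !A2.
by rewrite /linner !mxE /=; ring.
Qed.

Definition same_timelike_cone a b : Prop :=
  [/\ timelike a, timelike b & linner a b < 0].

Definition coshR (t : R) : R := (expR t + expR (- t)) / 2.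

Definition hyperbolic_angle a b (theta : R) : Prop :=
  0 <= theta /\ linner a b = - (llen a * llen b * coshR theta).

End Minkowski.

(* A parametrized surface is a map x : R * R -> 'rV[R]_3 restricted to a domain
   D; its tangent vectors at x p are the directional derivatives 'D_v x p. *)
Section Surfaces.
Variable R : realType.
Implicit Types (D : set (R * R)) (x : R * R -> 'rV[R]_3) (U : 'rV[R]_3).

(* Positive definiteness of the induced metric; in particular 'd x p is
   injective, so that a differentiable x is an immersion on D. *)
Definition spacelike_surface D x : Prop :=
  forall p, D p -> forall v : R * R, v != 0 ->
    0 < linner ('D_v x p) ('D_v x p).

(* The unit normals of a spacelike surface are timelike, hence -1. A continuous
   unit normal of a smooth immersion is automatically smooth. *)
Definition unit_normal_field D x (xi : R * R -> 'rV[R]_3) : Prop :=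
  {within D, continuous xi} /\
  forall p, D p -> linner (xi p) (xi p) = -1 /\
    forall v : R * R, linner (xi p) ('D_v x p) = 0.

Definition makes_constant_angle D x U (theta : R) : Prop :=
  exists xi, unit_normal_field D x xi /\
    forall p, D p ->
      same_timelike_cone (xi p) U /\ hyperbolic_angle (xi p) U theta.

Definition constant_angle_surface D x : Prop :=
  exists U theta, timelike U /\ makes_constant_angle D x U theta.

End Surfaces.

Section Curves.
Variable R : realType.
Implicit Types (I : set R) (g : R -> 'rV[R]_3).

Definition smooth_curve I g : Prop :=
  forall (n : nat) s, I s -> derivable (g^`(n)%classic) s 1.

Definition unit_speed_spacelike I g : Prop :=
  forall s, I s -> linner (g^`()%classic s) (g^`()%classic s) = 1.

Definition tangentT g : R -> 'rV[R]_3 := g^`()%classic.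
Definition curvature g (s : R) : R := llen (g^`(2)%classic s).
Definition normalN g (s : R) : 'rV[R]_3 := (curvature g s)^-1 *: g^`(2)%classic s.
Definition binormalB g (s : R) : 'rV[R]_3 := lcross (tangentT g s) (normalN g s).
Definition torsion g (s : R) : R :=
  - linner ((normalN g)^`()%classic s) (binormalB g s).

Definition helix I g : Prop :=
  exists v : 'rV[R]_3, v != 0 /\
    exists c : R, forall s, I s -> linner (g^`()%classic s) v = c.

Definition tangent_developable g (p : R * R) : 'rV[R]_3 :=
  g p.1 + p.2 *: g^`()%classic p.1.

Definition developable_domain I : set (R * R) := I `*` [set t | 0 < t].

Definition angle_direction g (s : R) : 'rV[R]_3 :=
  (Num.sqrt (curvature g s ^+ 2 - torsion g s ^+ 2))^-1 *:
    (- torsion g s *: tangentT g s + curvature g s *: binormalB g s).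

Definition angle_cosh g (s : R) : R :=
  curvature g s / Num.sqrt (curvature g s ^+ 2 - torsion g s ^+ 2).

End Curves.

(* Main.v *)
(* Along a Frenet frame (T, N, B) the unit normals of M are +-B, so M makes a
   constant angle with U iff <B, U> is constant up to sign, whence
   tau <N, U> = 0. Where tau does not vanish this forces <N, U> = 0 and
   tau / kappa = <T, U> / <B, U>, with zero derivative; hence (tau / kappa)^2 has
   zero derivative everywhere, and tau vanishes identically or nowhere. In the
   first case B is constant and is an axis of the helix; in the second one U
   itself is an axis. Conversely, on a helix r = tau / kappa is constant, so
   that - r T + B has zero derivative and, normalized, is the direction U. *)
Require Import Defs.
From mathcomp Require Import all_boot all_order all_algebra.
From mathcomp Require Import all_classical all_reals all_analysis.
From mathcomp Require Import ring lra.

Set Implicit Arguments.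
Unset Strict Implicit.
Unset Printing Implicit Defensive.

Import Order.TTheory GRing.Theory Num.Theory.
Import numFieldNormedType.Exports.
Local Open Scope classical_set_scope.
Local Open Scope ring_scope.

(** * Algebra of the Lorentzian inner and cross products *)

Section LorentzAlgebra.
Variable R : realType.
Implicit Types u v w : 'rV[R]_3.

Lemma linnerC u v : linner u v = linner v u.
Proof. by rewrite /linner; ring. Qed.

Lemma linnerDl u v w : linner (u + v) w = linner u w + linner v w.
Proof. by rewrite /linner !mxE; ring. Qed.

Lemma linnerZl a u v : linner (a *: u) v = a * linner u v.
Proof. by rewrite /linner !mxE; ring. Qed.

Lemma linnerDr u v w : linner w (u + v) = linner w u + linner w v.
Proof. by rewrite /linner !mxE; ring. Qed.

Lemma linnerZr a u v : linner v (a *: u) = a * linner v u.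
Proof. by rewrite /linner !mxE; ring. Qed.

Lemma linner0l u : linner 0 u = 0.
Proof. by rewrite /linner !mxE; ring. Qed.

Lemma linner0r u : linner u 0 = 0.
Proof. by rewrite linnerC linner0l. Qed.

Lemma lcrossDr u v w : lcross w (u + v) = lcross w u + lcross w v.
Proof.
by apply/rowP => j; rewrite /lcross !mxE; case: ifP => _; [|case: ifP => _]; ring.
Qed.

Lemma lcrossZl a u v : lcross (a *: u) v = a *: lcross u v.
Proof.
by apply/rowP => j; rewrite /lcross !mxE; case: ifP => _; [|case: ifP => _]; ring.
Qed.

Lemma lcrossZr a u v : lcross v (a *: u) = a *: lcross v u.
Proof.
by apply/rowP => j; rewrite /lcross !mxE; case: ifP => _; [|case: ifP => _]; ring.
Qed.

Lemma lcross_self u : lcross u u = 0.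
Proof.
by apply/rowP => j; rewrite /lcross !mxE; case: ifP => _; [|case: ifP => _]; ring.
Qed.

Lemma linner_crossl u v : linner (lcross u v) u = 0.
Proof. by rewrite /linner /lcross !mxE /=; ring. Qed.

Lemma linner_crossr u v : linner (lcross u v) v = 0.
Proof. by rewrite /linner /lcross !mxE /=; ring. Qed.

(** Lagrange identity with the sign opposite to the Euclidean one: the cross product of two
    orthonormal spacelike vectors is unit timelike. *)
Lemma linner_cross_cross u v :
  linner (lcross u v) (lcross u v) =
  linner u v ^+ 2 - linner u u * linner v v.
Proof. by rewrite /linner /lcross !mxE /=; ring. Qed.

Lemma ord3E (i : 'I_3) : [\/ i = 0, i = 1 | i = 2].
Proof.
case: i => [[|[|[|//]]]] ?; [apply: Or31|apply: Or32|apply: Or33]; exact: val_inj.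
Qed.

Lemma lcross_cross u v w :
  lcross u (lcross v w) = linner u v *: w - linner u w *: v.
Proof.
apply/rowP => j; rewrite /linner /lcross !mxE /=.
by case: (ord3E j) => -> /=; ring.
Qed.

(* Cramer's rule for the triple (u, v, u x v). *)
Lemma lcross_expand u v w :
  linner (lcross u v) (lcross u v) *: w =
  linner w (lcross u v) *: lcross u v
  + (linner w v * linner u v - linner w u * linner v v) *: u
  + (linner w u * linner u v - linner w v * linner u u) *: v.
Proof.
apply/rowP => j; rewrite /linner /lcross !mxE /=.
by case: (ord3E j) => -> /=; ring.
Qed.

(** Specializes Cramer's rule to an orthonormal pair; the last sign is negative because [lcross u v]
    has square -1. *)
Lemma frame_expand u v w : linner u u = 1 -> linner v v = 1 -> linner u v = 0 ->
  w = linner w u *: u + linner w v *: v - linner w (lcross u v) *: lcross u v.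
Proof.
move=> uu vv uv; have := lcross_expand u v w.
rewrite linner_cross_cross uu vv uv => /(congr1 -%R).
rewrite expr0n /= mulr1 sub0r scaleN1r opprK => wE; rewrite [LHS]wE.
by apply/rowP => j; rewrite !mxE; ring.
Qed.

Lemma frame_norm u v w : linner u u = 1 -> linner v v = 1 -> linner u v = 0 ->
  linner w w = linner u w ^+ 2 + linner v w ^+ 2 - linner (lcross u v) w ^+ 2.
Proof.
move=> uu vv uv; rewrite [in LHS](frame_expand w uu vv uv).
have zz : linner (lcross u v) (lcross u v) = -1.
  by rewrite linner_cross_cross uu vv uv; ring.
have zu := linner_crossl u v; have zv := linner_crossr u v.
move: (lcross u v) zz zu zv => z zz zu zv.
rewrite -scaleNr !(linnerDl, linnerDr, linnerZl, linnerZr).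
rewrite (linnerC u z) (linnerC v z) (linnerC v u) zz zu zv uu vv uv.
by rewrite (linnerC u w) (linnerC v w) (linnerC z w); ring.
Qed.

End LorentzAlgebra.

(** * Differentiation of vector-valued maps, and constancy on intervals *)

Section Calculus.
Variable R : realType.

Lemma is_derive_mxP (V : normedModType R) m n (M : V -> 'M[R]_(m, n)) dM t v :
  is_derive t v M dM <-> forall i j, is_derive t v (fun x => M x i j) (dM i j).
Proof.
split=> [[dMt <-] i j|dMt].
  rewrite derive_mx// mxE; apply: derivableP.
  by move/derivable_mxP : dMt.
have dM' : derivable M t v by apply/derivable_mxP => i j; have [] := dMt i j.
apply: DeriveDef => //; rewrite derive_mx//; apply/matrixP => i j.
by rewrite mxE; have [] := dMt i j.
Qed.

Lemma is_derive_scale (V : normedModType R) m n (a : V -> R) da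
    (M : V -> 'M[R]_(m, n)) dM t v :
  is_derive t v a da -> is_derive t v M dM ->
  is_derive t v (fun x => a x *: M x) (da *: M t + a t *: dM).
Proof.
move=> ? /is_derive_mxP dMt; apply/is_derive_mxP => i j.
have ? := dMt i j.
rewrite (_ : (fun x => _) = a * (fun x => M x i j)); last first.
  by apply/funext => x; rewrite !mxE.
by apply: is_derive_eq; rewrite !mxE /GRing.scale/= addrC (mulrC da).
Qed.

Lemma is_derive_linner (V : normedModType R) (u w : V -> 'rV[R]_3) du dw t v :
  is_derive t v u du -> is_derive t v w dw ->
  is_derive t v (fun x => linner (u x) (w x))
    (linner du (w t) + linner (u t) dw).
Proof.
move=> /is_derive_mxP ut /is_derive_mxP wt.
have [? ? ?] := And3 (ut 0 0) (ut 0 1) (ut 0 2).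
have [? ? ?] := And3 (wt 0 0) (wt 0 1) (wt 0 2).
rewrite (_ : (fun x => _) = (fun x => u x 0 0) * (fun x => w x 0 0)
  + (fun x => u x 0 1) * (fun x => w x 0 1)
  - (fun x => u x 0 2) * (fun x => w x 0 2)); last exact/funext.
by apply: is_derive_eq; rewrite /linner /GRing.scale/=; ring.
Qed.

Lemma is_derive_lcross (V : normedModType R) (u w : V -> 'rV[R]_3) du dw t v :
  is_derive t v u du -> is_derive t v w dw ->
  is_derive t v (fun x => lcross (u x) (w x))
    (lcross du (w t) + lcross (u t) dw).
Proof.
move=> /is_derive_mxP ut /is_derive_mxP wt.
have minor i j i' j' : is_derive t v
      (fun x => u x 0 i * w x 0 j - u x 0 i' * w x 0 j')
      ((du 0 i * w t 0 j - du 0 i' * w t 0 j')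
       + (u t 0 i * dw 0 j - u t 0 i' * dw 0 j')).
  have [? ? ? ?] := And4 (ut 0 i) (wt 0 j) (ut 0 i') (wt 0 j').
  rewrite (_ : (fun x => _) = (fun x => u x 0 i) * (fun x => w x 0 j)
    - (fun x => u x 0 i') * (fun x => w x 0 j')); last exact/funext.
  by apply: is_derive_eq; rewrite /GRing.scale/=; ring.
apply/is_derive_mxP => i j; rewrite (ord1 i) !mxE.
under eq_fun do rewrite mxE.
by case: (ord3E j) => -> /=; exact: minor.
Qed.

Lemma is_derive_fst (W : normedModType R) (f : R -> W) df (p v : R * R) :
  is_derive p.1 1 f df -> is_derive p v (fun q => f q.1) (v.1 *: df).
Proof.
move=> [dfp dfE]; have dfp' : differentiable f p.1 by exact/derivable1_diffP.
have d1 : differentiable (fst : R * R -> R) p.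
  by apply: linear_differentiable => /= x; exact: cvg_fst.
have dp : differentiable (fun q => f q.1) p.
  exact: (@differentiable_comp _ _ _ _ fst f).
apply: DeriveDef; first exact: diff_derivable.
rewrite deriveE// (@diff_comp _ _ _ _ fst f)//=.
rewrite (@diff_lin _ _ _ fst)//=; last by move=> x; exact: cvg_fst.
by rewrite deriv1E// derive1E dfE.
Qed.

(** The device by which an identity that holds around a point is differentiated: the derivative
    computed by the usual rules must be that of a constant. *)
Lemma near_cst_is_derive0 (V W : normedModType R) (f : V -> W) (c df : W) t v :
  (\near t, f t = c) -> is_derive t v f df -> df = 0.
Proof.
move=> fc dft; have [_ <-] : is_derive t v (cst c) df.
  exact: near_eq_is_derive dft.
exact: derive_cst.
Qed.

Lemma is_interval_cst (I : set R) (f : R -> R) : is_interval I ->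
  (forall s, I s -> is_derive s 1 f 0) -> forall x y, I x -> I y -> f x = f y.
Proof.
move=> itvI df.
(* By symmetry the points may be ordered; the mean value theorem then applies on [[x, y]], which
   lies in [I]. *)
suff lt x y : I x -> I y -> x <= y -> f x = f y.
  move=> x y Ix Iy; have [/lt|/ltW/lt] := leP x y; first exact.
  by move=> ->.
move=> Ix Iy xy; have Ixy z : z \in `[x, y] -> I z.
  by rewrite in_itv/=; exact: itvI.
have [||c _] := @MVT_segment _ f (cst 0) x y xy.
- by move=> z /subset_itv_oo_cc /Ixy/df.
- apply: derivable_within_continuous => z /Ixy/df [] //.
- by rewrite /cst mul0r => /eqP; rewrite subr_eq0 => /eqP ->.
Qed.

Lemma is_interval_cst_mx (I : set R) m n (M : R -> 'M[R]_(m, n)) :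
  is_interval I -> (forall s, I s -> is_derive s 1 M 0) ->
  forall s1 s2, I s1 -> I s2 -> M s1 = M s2.
Proof.
move=> itvI dM s1 s2 Is1 Is2; apply/matrixP => i j.
apply: (is_interval_cst (f := fun s => M s i j)) itvI _ _ _ Is1 Is2 => s Is.
by have /is_derive_mxP/(_ i j) := dM _ Is; rewrite mxE.
Qed.

End Calculus.

(** * Hyperbolic cosine and Lorentzian length of timelike vectors *)

Section HyperbolicAngle.
Variable R : realType.

Lemma coshR_gt0 (t : R) : 0 < coshR t.
Proof. by rewrite /coshR divr_gt0// addr_gt0// expR_gt0. Qed.

Lemma coshR_surj (y : R) : 1 <= y -> exists2 t, 0 <= t & coshR t = y.
Proof.
move=> y1; set r := Num.sqrt (y ^+ 2 - 1).
have r2 : r ^+ 2 = y ^+ 2 - 1.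
  by rewrite sqr_sqrtr// subr_ge0 expr_ge1// (le_trans ler01).
have r0 : 0 <= r by exact: sqrtr_ge0.
(* The explicit inverse hyperbolic cosine: since [(y + r) * (y - r) = 1], the two exponentials are
   [y + r] and [y - r], with mean [y]. *)
exists (ln (y + r)); first by rewrite ln_ge0//; lra.
have yr0 : 0 < y + r by lra.
rewrite /coshR expRN lnK ?posrE//.
have -> : (y + r)^-1 = y - r.
  apply: (mulfI (lt0r_neq0 yr0)); rewrite divff ?lt0r_neq0//.
  have -> : (y + r) * (y - r) = y ^+ 2 - r ^+ 2 by ring.
  by rewrite r2; ring.
by field.
Qed.

Lemma linner_llen_sq (w : 'rV[R]_3) : timelike w -> llen w ^+ 2 = - linner w w.
Proof. by move=> w0; rewrite /llen sqr_sqrtr// ltr0_norm. Qed.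

Lemma timelike_llen_gt0 (w : 'rV[R]_3) : timelike w -> 0 < llen w.
Proof. by move=> w0; rewrite /llen sqrtr_gt0 normr_gt0 lt_eqF. Qed.

Lemma unit_timelike_llen (w : 'rV[R]_3) : linner w w = -1 -> llen w = 1.
Proof. by move=> w1; rewrite /llen w1 normrN normr1 sqrtr1. Qed.

End HyperbolicAngle.

(* Kept abstract because failing unification attempts would unfold [torsion g]
   and the like down to limits. *)
Record frenet_frame (R : realType) (I : set R) (T N B : R -> 'rV[R]_3)
    (k tau : R -> R) : Prop := FrenetFrame {
  frame_TT : forall s, I s -> linner (T s) (T s) = 1;
  frame_NN : forall s, I s -> linner (N s) (N s) = 1;
  frame_TN : forall s, I s -> linner (T s) (N s) = 0;
  frame_BE : forall s, B s = lcross (T s) (N s);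
  frame_dT : forall s, I s -> is_derive s 1 T (k s *: N s);
  frame_dN : forall s, I s -> is_derive s 1 N (- k s *: T s + tau s *: B s);
  frame_k_gt0 : forall s, I s -> 0 < k s;
  frame_derivable_kV : forall s, I s -> derivable (fun y => (k y)^-1) s 1;
  frame_derivable_tau : forall s, I s -> derivable tau s 1 }.

(** * Consequences of the Frenet equations *)

Section FrenetFrame.
Variables (R : realType) (I : set R) (T N B : R -> 'rV[R]_3) (k tau : R -> R).
Hypotheses (I_itv : is_interval I) (I_open : open I).
Hypothesis F : frenet_frame I T N B k tau.

(** Openness of [I] lets identities on [I] be differentiated at each of its points. *)
Lemma near_domain s : I s -> \near s, I s.
Proof. by move=> Is; apply: open_nbhs_nbhs. Qed.

Lemma frame_k_neq0 s : I s -> k s != 0.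
Proof. by move=> Is; rewrite gt_eqF// (frame_k_gt0 F). Qed.

Lemma frame_BB s : I s -> linner (B s) (B s) = -1.
Proof.
move=> Is; rewrite (frame_BE F) linner_cross_cross.
by rewrite (frame_TN F)// (frame_TT F)// (frame_NN F)//; ring.
Qed.

Lemma frame_BT s : linner (B s) (T s) = 0.
Proof. by rewrite (frame_BE F) linner_crossl. Qed.

Lemma frame_BN s : linner (B s) (N s) = 0.
Proof. by rewrite (frame_BE F) linner_crossr. Qed.

Lemma frenet_expand s w : I s ->
  w = linner (T s) w *: T s + linner (N s) w *: N s - linner (B s) w *: B s.
Proof.
move=> Is; rewrite !(linnerC _ w) (frame_BE F); apply: frame_expand.
- exact: (frame_TT F).
- exact: (frame_NN F).
- exact: (frame_TN F).
Qed.

Lemma frenet_norm s w : I s -> linner w w =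
  linner (T s) w ^+ 2 + linner (N s) w ^+ 2 - linner (B s) w ^+ 2.
Proof.
move=> Is; rewrite (frame_BE F); apply: frame_norm.
- exact: (frame_TT F).
- exact: (frame_NN F).
- exact: (frame_TN F).
Qed.

(** In the derivative of [T x N] the terms [N x N] and [T x T] vanish, and
    [T x B = T x (T x N) = N]. *)
Lemma frame_dB s : I s -> is_derive s 1 B (tau s *: N s).
Proof.
move=> Is; rewrite (funext (frame_BE F)).
apply: is_derive_eq (is_derive_lcross (frame_dT F Is) (frame_dN F Is)) _.
rewrite lcrossZl lcross_self scaler0 add0r lcrossDr !lcrossZr lcross_self.
rewrite scaler0 add0r (frame_BE F) lcross_cross (frame_TT F)// (frame_TN F)//.
by rewrite scale0r subr0 scale1r.
Qed.

(** * Frame components of a fixed vector *)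

Section FixedDirection.
Variable U : 'rV[R]_3.

Lemma is_derive_linnerT s : I s ->
  is_derive s 1 (fun y => linner (T y) U) (k s * linner (N s) U).
Proof.
move=> Is.
apply: is_derive_eq (is_derive_linner (frame_dT F Is) (is_derive_cst U _ _)) _.
by rewrite linner0r addr0 linnerZl.
Qed.

Lemma is_derive_linnerN s : I s -> is_derive s 1 (fun y => linner (N y) U)
  (- k s * linner (T s) U + tau s * linner (B s) U).
Proof.
move=> Is.
apply: is_derive_eq (is_derive_linner (frame_dN F Is) (is_derive_cst U _ _)) _.
by rewrite linner0r addr0 linnerDl !linnerZl.
Qed.

Lemma is_derive_linnerB s : I s ->
  is_derive s 1 (fun y => linner (B y) U) (tau s * linner (N s) U).
Proof.
move=> Is.
apply: is_derive_eq (is_derive_linner (frame_dB Is) (is_derive_cst U _ _)) _.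
by rewrite linner0r addr0 linnerZl.
Qed.

Lemma linnerN0_linnerT_cst s1 s2 : (forall s, I s -> linner (N s) U = 0) ->
  I s1 -> I s2 -> linner (T s1) U = linner (T s2) U.
Proof.
move=> NU; apply: (is_interval_cst (f := fun s => linner (T s) U)) I_itv _ _ _.
by move=> s Is; have := is_derive_linnerT Is; rewrite NU// mulr0.
Qed.

Lemma linnerN0_linnerB_cst s1 s2 : (forall s, I s -> linner (N s) U = 0) ->
  I s1 -> I s2 -> linner (B s1) U = linner (B s2) U.
Proof.
move=> NU; apply: (is_interval_cst (f := fun s => linner (B s) U)) I_itv _ _ _.
by move=> s Is; have := is_derive_linnerB Is; rewrite NU// mulr0.
Qed.

(** The derivative of [<N, U>] is [- k <T, U> + tau <B, U>], which must vanish. *)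
Lemma near_linnerN0 s : I s -> (\near s, linner (N s) U = 0) ->
  k s * linner (T s) U = tau s * linner (B s) U.
Proof.
move=> Is NU; have /eqP := near_cst_is_derive0 NU (is_derive_linnerN Is).
by rewrite mulNr addrC subr_eq0 => /eqP.
Qed.

End FixedDirection.

(** * From a constant angle with the binormal to a helix *)

Section ConstantAngle.
Variables (U : 'rV[R]_3) (C : R).
Hypothesis U_timelike : timelike U.
Hypothesis U_angle : forall s, I s -> linner (B s) U ^+ 2 = C.

(** The [B] component is the only negative contribution to [<U, U>], which is negative. *)
Lemma linnerB_neq0 s : I s -> linner (B s) U != 0.
Proof.
move=> Is; move: U_timelike; rewrite /timelike (frenet_norm U Is).
by case: eqVneq => // -> /=; nra.
Qed.

(** Differentiating [<B, U> ^+ 2 = C] gives twice [<B, U> * (tau * <N, U>)], and [<B, U>] can be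
    cancelled. *)
Lemma torsion_linnerN s : I s -> tau s * linner (N s) U = 0.
Proof.
move=> Is; have dB := is_derive_linnerB U Is.
have : linner (B s) U * (tau s * linner (N s) U) +
       linner (B s) U * (tau s * linner (N s) U) = 0.
  apply: (near_cst_is_derive0 (c := C)) (is_deriveM dB dB); near=> y.
  rewrite -[LHS]/(linner (B y) U * linner (B y) U) -expr2.
  by apply: U_angle; near: y; exact: near_domain.
rewrite -mulr2n -mulrnAr => /eqP; rewrite mulf_eq0 (negbTE (linnerB_neq0 Is))/=.
by rewrite mulrn_eq0 => /eqP.
Unshelve. all: by end_near. Qed.

Lemma near_torsion_neq0 s : I s -> tau s != 0 -> \near s, tau s != 0.
Proof.
move=> Is; have /derivable1_diffP/differentiable_continuous :=
  frame_derivable_tau F Is.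
exact: cvgr_neq0.
Qed.

Lemma torsion_neq0_linnerN s : I s -> tau s != 0 -> linner (N s) U = 0.
Proof.
move=> Is tau0; apply: (mulfI tau0).
by rewrite mulr0 torsion_linnerN.
Qed.

(** By continuity [tau] is nonzero around [s], so [<N, U>] vanishes on a neighbourhood and not
    merely at [s]. *)
Lemma curvature_linnerT s : I s -> tau s != 0 ->
  k s * linner (T s) U = tau s * linner (B s) U.
Proof.
move=> Is tau0; apply: near_linnerN0 => //; near=> y.
apply: torsion_neq0_linnerN; near: y; first exact: near_domain.
exact: near_torsion_neq0.
Unshelve. all: by end_near. Qed.

(* Where [tau] vanishes the square of [tau / k] has zero derivative anyway,
   and elsewhere [tau / k = <T, U> / <B, U>], a quotient of two functions with
   zero derivative. *)
Lemma torsion_curvature_sq_cst s1 s2 : I s1 -> I s2 ->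
  (tau s1 / k s1) ^+ 2 = (tau s2 / k s2) ^+ 2.
Proof.
apply: (is_interval_cst (f := fun y => (tau y / k y) ^+ 2)) I_itv _ _ _ => s Is.
pose r := tau * (fun y => (k y)^-1).
have dr : is_derive s 1 r ('D_1 r s).
  apply: derivableP.
  exact: derivableM (frame_derivable_tau F Is) (frame_derivable_kV F Is).
suff rr : r s * 'D_1 r s = 0.
  apply: is_derive_eq (is_deriveX 2 dr) _.
  by rewrite /GRing.scale/= -mulrA rr mulr0.
have [tau0|tau0] := eqVneq (tau s) 0.
  by rewrite -[r s]/(tau s * (k s)^-1) tau0 !mul0r.
have NU := torsion_neq0_linnerN Is tau0.
have dT := is_derive_linnerT U Is; have dB := is_derive_linnerB U Is.
rewrite NU mulr0 in dT; rewrite NU mulr0 in dB.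
(* The relation [r <B, U> - <T, U> = 0] is differentiated in place of the quotient; both components
   of [U] have zero derivative at [s], which leaves [<B, U> * r' = 0]. *)
have : r s *: 0 + linner (B s) U *: 'D_1 r s - 0 = 0.
  apply: (near_cst_is_derive0 (c := 0)) (is_deriveB (is_deriveM dr dB) dT).
  near=> y.
  have Iy : I y by near: y; exact: near_domain.
  have tauy : tau y != 0 by near: y; exact: near_torsion_neq0.
  rewrite -[LHS]/(tau y * (k y)^-1 * linner (B y) U - linner (T y) U) mulrAC.
  by rewrite -curvature_linnerT// mulrAC divff ?frame_k_neq0// mul1r subrr.
rewrite scaler0 add0r subr0 => /eqP.
rewrite scaler_eq0 (negbTE (linnerB_neq0 Is))/= => /eqP ->.
by rewrite mulr0.
Unshelve. all: by end_near. Qed.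

Lemma torsion_neq0 s0 s : I s0 -> tau s0 != 0 -> I s -> tau s != 0.
Proof.
move=> Is0 tau0 Is; apply: contraNneq tau0 => taus.
have := torsion_curvature_sq_cst Is0 Is.
rewrite taus mul0r expr0n/= => /eqP.
by rewrite sqrf_eq0 mulf_eq0 invr_eq0 (negbTE (frame_k_neq0 Is0)) orbF.
Qed.

(** Since [<N, U>] vanishes on [I], the other two components [a = <T, U>] and [b = <B, U>] are
    constant and [U = a T - b B]. Then [r = a / b] is [tau / k], and [U] being timelike means
    [a ^+ 2 < b ^+ 2]. *)
Lemma torsion_neq0_direction s0 : I s0 -> tau s0 != 0 ->
  exists r b, [/\ r ^+ 2 < 1, b != 0, forall s, I s -> tau s = r * k s &
    forall s, I s -> U = b *: (- r *: T s + B s)].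
Proof.
move=> Is0 tau0; have NU s : I s -> linner (N s) U = 0.
  by move=> Is; apply: torsion_neq0_linnerN => //; exact: torsion_neq0 tau0 _.
have TU s Is := @linnerN0_linnerT_cst _ s s0 NU Is Is0.
have BU s Is := @linnerN0_linnerB_cst _ s s0 NU Is Is0.
have b0 := linnerB_neq0 Is0.
have UU := frenet_norm U Is0; move: U_timelike; rewrite /timelike UU NU//.
move: TU BU b0; set a := linner (T s0) U; set b := linner (B s0) U => TU BU b0.
have aE : a = a / b * b by rewrite divfK.
move: aE; set r := a / b => aE.
rewrite expr0n addr0 aE exprMn subr_lt0 gtr_pMl ?exprn_even_gt0//= => r1.
(* The factor is [- b] because the [B] component enters the frame expansion with a minus sign. *)
exists r, (- b); split; rewrite ?oppr_eq0// => s Is.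
  apply: (mulIf b0); rewrite -(BU _ Is).
  rewrite -(curvature_linnerT Is (torsion_neq0 Is0 tau0 Is)).
  by rewrite TU// aE BU//; ring.
rewrite [LHS](frenet_expand U Is) NU// TU// BU// aE scale0r addr0.
by rewrite scalerDr scalerA mulrNN mulrC scaleNr.
Qed.

Lemma constant_angle_frame_helix :
  (exists v, v != 0 /\ exists c, forall s, I s -> linner (T s) v = c) /\
  forall s, I s -> tau s ^+ 2 < k s ^+ 2.
Proof.
have [[s0 Is0 tau0]|tau0] := pselect (exists2 s, I s & tau s != 0).
  have NU s : I s -> linner (N s) U = 0.
    by move=> Is; apply: torsion_neq0_linnerN => //; exact: torsion_neq0 tau0 _.
  split=> [|s Is].
    exists U; split.
      by apply: contraTneq U_timelike => ->; rewrite /timelike linner0l ltxx.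
    by exists (linner (T s0) U) => s Is; exact: linnerN0_linnerT_cst.
  have [r [b [r1 _ -> // _]]] := torsion_neq0_direction Is0 tau0.
  by rewrite exprMn gtr_pMl// exprn_gt0// (frame_k_gt0 F).
have {}tau0 s : I s -> tau s = 0.
  by move=> Is; apply: contra_notP tau0 => /eqP ?; exists s.
split=> [|s Is]; last by rewrite tau0// expr0n/= exprn_gt0// (frame_k_gt0 F).
have [[s0 Is0]|I0] := pselect (exists s, I s); last first.
  (* Here [I] is empty, so any nonzero vector serves as axis. *)
  exists (const_mx 1); split; last by exists 0 => s Is; case: I0; exists s.
  by apply/eqP => /rowP/(_ 0); rewrite !mxE => /eqP; rewrite oner_eq0.
exists (B s0); split.
  apply/eqP => B0; have := frame_BB Is0; rewrite B0 linner0l => /eqP.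
  by rewrite eq_sym oppr_eq0 oner_eq0.
(* With zero torsion [B] is constant, so [B s0] is orthogonal to every [T s]. *)
exists 0 => s Is; rewrite (is_interval_cst_mx (M := B) I_itv _ Is0 Is).
  by rewrite linnerC frame_BT.
by move=> y Iy; have := frame_dB Iy; rewrite tau0// scale0r.
Qed.

End ConstantAngle.

(** * From a helix to a constant frame direction *)

(** Differentiating [<T, v> = c] gives [<N, v> = 0]; hence [<B, v>] is constant, and a second
    differentiation gives [k c = tau <B, v>]. If [<B, v>] were zero, so would be [c], and [v] would
    have no component left. *)
Lemma frame_helix_ratio_cst v c : I !=set0 -> v != 0 ->
  (forall s, I s -> linner (T s) v = c) ->
  exists r, forall s, I s -> tau s = r * k s.
Proof.
move=> [s0 Is0] v0 Tv.
have Nv s : I s -> linner (N s) v = 0.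
  move=> Is; apply: (mulfI (frame_k_neq0 Is)); rewrite mulr0.
  apply: near_cst_is_derive0 (is_derive_linnerT v Is).
  by near=> y; apply: Tv; near: y; exact: near_domain.
have kc s : I s -> k s * c = tau s * linner (B s0) v.
  move=> Is; rewrite -(linnerN0_linnerB_cst Nv Is Is0) -(Tv _ Is).
  apply: near_linnerN0 => //.
  by near=> y; apply: Nv; near: y; exact: near_domain.
have Bv0 : linner (B s0) v != 0.
  apply: contra_neq v0 => Bv0; have /eqP := kc _ Is0.
  rewrite Bv0 mulr0 mulf_eq0 (negbTE (frame_k_neq0 Is0))/= => /eqP c0.
  rewrite (frenet_expand v Is0) Bv0 Nv// Tv// c0.
  by rewrite !scale0r addr0 subr0.
exists (c / linner (B s0) v) => s Is; apply: (mulIf Bv0).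
by rewrite -kc// mulrAC divfK// mulrC.
Unshelve. all: by end_near. Qed.

Lemma frame_angle_vector_norm r s : I s ->
  linner (- r *: T s + B s) (- r *: T s + B s) = r ^+ 2 - 1.
Proof.
move=> Is; rewrite !linnerDl !linnerDr !linnerZl !linnerZr.
by rewrite (frame_TT F)// frame_BB// (linnerC (T s) (B s)) frame_BT; ring.
Qed.

(** The derivative is [(- r k + tau) N], hence zero. *)
Lemma frame_angle_vector_cst r s1 s2 : (forall s, I s -> tau s = r * k s) ->
  I s1 -> I s2 -> - r *: T s1 + B s1 = - r *: T s2 + B s2.
Proof.
move=> tauE.
apply: (is_interval_cst_mx (M := fun s => - r *: T s + B s)) I_itv _ _ _ => s Is.
have dW := is_deriveD (is_deriveZ (- r) (frame_dT F Is)) (frame_dB Is).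
apply: is_derive_eq dW _.
by rewrite scalerA -scalerDl tauE// mulNr addNr scale0r.
Qed.

End FrenetFrame.

(** * The Frenet frame of the generating curve and the tangent planes of the surface *)

Section SpacelikeDevelopable.
Variables (R : realType) (I : set R) (g : R -> 'rV[R]_3).
Hypothesis I_open : open I.
Hypothesis g_smooth : smooth_curve I g.
Hypothesis g_unit : unit_speed_spacelike I g.
Hypothesis M_spacelike :
  spacelike_surface (developable_domain I) (tangent_developable g).

Let D := developable_domain I.
Let x := tangent_developable g.
Let T := tangentT g.
Let N := normalN g.
Let B := binormalB g.
Let k := curvature g.
Let tau := torsion g.

Lemma is_derive_derive1n n s : I s ->
  is_derive s 1 g^`(n)%classic (g^`(n.+1)%classic s).
Proof. by move=> Is; rewrite derive1nS derive1E; exact/derivableP/g_smooth. Qed.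

Lemma is_derive_tangentT s : I s -> is_derive s 1 T (g^`(2)%classic s).
Proof. by rewrite /T /tangentT -derive1n1; exact: is_derive_derive1n. Qed.

Lemma linner_velocity_accel s : I s -> linner (T s) (g^`(2)%classic s) = 0.
Proof.
move=> Is; have dT := is_derive_tangentT Is.
have : linner (g^`(2)%classic s) (T s) + linner (T s) (g^`(2)%classic s) = 0.
  apply: near_cst_is_derive0 (is_derive_linner dT dT).
  by near=> y; apply: g_unit; near: y; exact: near_domain.
by rewrite linnerC; lra.
Unshelve. all: by end_near. Qed.

Lemma derive_developable s t v : I s ->
  'D_v x (s, t) = v.1 *: T s + (v.2 *: T s + t *: (v.1 *: g^`(2)%classic s)).
Proof.
move=> Is; have dg : is_derive s 1 g (T s).
  by have := is_derive_derive1n 0 Is; rewrite derive1n1.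
have dx1 := @is_derive_fst R _ g (T s) (s, t) v dg.
have dT := @is_derive_fst R _ T _ (s, t) v (is_derive_tangentT Is).
have dsnd : is_derive (s, t) v (snd : R * R -> R) v.2.
  have csnd : continuous (snd : R * R -> R) by move=> ?; exact: cvg_snd.
  have ? : differentiable (snd : R * R -> R) (s, t).
    exact: linear_differentiable.
  apply: DeriveDef; first exact: diff_derivable.
  by rewrite deriveE// (@diff_lin _ _ _ snd).
by have := is_derive_scale dsnd dT => ?; apply: derive_val.
Qed.

Lemma linner_accel_gt0 s : I s ->
  0 < linner (g^`(2)%classic s) (g^`(2)%classic s).
Proof.
move=> Is; have Ds : developable_domain I (s, 1) by split => //=; exact: ltr01.
(* At [(s, 1)] the direction [(1, -1)] cancels the two [T] terms, so the tangent vector is exactly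
   the acceleration. *)
have v0 : (1, -1) != 0 :> R * R by rewrite -pair_eqE /= oner_eq0.
have := M_spacelike Ds v0; rewrite derive_developable//=.
by rewrite scaleN1r !scale1r addrA subrr add0r.
Qed.

Lemma curvature_gt0 s : I s -> 0 < k s.
Proof.
move=> Is; rewrite /k /curvature /llen sqrtr_gt0 normr_gt0.
by rewrite gt_eqF// linner_accel_gt0.
Qed.

Lemma accelE s : I s -> g^`(2)%classic s = k s *: N s.
Proof.
move=> Is; rewrite /N /normalN scalerA divff ?scale1r//.
by rewrite gt_eqF// curvature_gt0.
Qed.

(** As [t] and [k s] are positive on the domain, the tangent plane is spanned by [T] and [N], the
    same along a whole ruling. *)
Lemma derive_developable_frame s t v : I s ->
  'D_v x (s, t) = (v.1 + v.2) *: T s + (t * v.1 * k s) *: N s.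
Proof.
move=> Is; rewrite derive_developable// addrA -scalerDl scalerA.
by congr (_ + _); rewrite -[RHS]scalerA; congr (_ *: _); exact: accelE.
Qed.

Lemma linner_TT s : I s -> linner (T s) (T s) = 1.
Proof. exact: g_unit. Qed.

Lemma linner_TN s : I s -> linner (T s) (N s) = 0.
Proof. by move=> Is; rewrite linnerZr linner_velocity_accel// mulr0. Qed.

Lemma linner_NN s : I s -> linner (N s) (N s) = 1.
Proof.
move=> Is; have g2 := linner_accel_gt0 Is; have k0 := curvature_gt0 Is.
rewrite linnerZl linnerZr mulrA -expr2 exprVn.
rewrite /curvature /llen sqr_sqrtr// gtr0_norm// mulVf//.
by rewrite gt_eqF.
Qed.

(** Strict positivity of the squared acceleration keeps the square root differentiable and removes
    the absolute value around [s]. *)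
Lemma derivable_curvature s : I s -> derivable k s 1.
Proof.
move=> Is; have dg2 := is_derive_derive1n 2 Is.
have dsq := is_derive_linner dg2 dg2.
have [dsqrt _] := @is_derive1_comp R Num.sqrt _ s _ _
  (is_derive1_sqrt (linner_accel_gt0 Is)) dsq.
apply: near_eq_derivable dsqrt; near=> y.
rewrite /k /curvature /llen gtr0_norm//; apply: linner_accel_gt0.
by near: y; exact: near_domain.
Unshelve. all: by end_near. Qed.

Lemma derivable_curvatureV s : I s -> derivable (fun y => (k y)^-1) s 1.
Proof.
move=> Is; apply: derivableV; last exact: derivable_curvature.
by rewrite gt_eqF// curvature_gt0.
Qed.

Lemma derive_normalN s : I s -> is_derive s 1 N
  ('D_1 (fun y => (k y)^-1) s *: (k s *: N s)
   + (k s)^-1 *: g^`(3)%classic s).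
Proof.
move=> Is; have dk := derivableP (derivable_curvatureV Is).
apply: is_derive_eq (is_derive_scale dk (is_derive_derive1n 2 Is)) _.
by congr (_ *: _ + _); exact: accelE.
Qed.

(** The part of [N'] along [N] is orthogonal to [B]. The resulting formula avoids the derivative of
    [N], so that [tau] can itself be differentiated. *)
Lemma torsionE s : I s ->
  tau s = - ((k s)^-1 * linner (g^`(3)%classic s) (B s)).
Proof.
move=> Is; rewrite /tau /torsion derive1E; have [_ ->] := derive_normalN Is.
have linner_drop (a b : R) (n w z : 'rV[R]_3) :
    linner n z = 0 -> linner (a *: n + b *: w) z = b * linner w z.
  by rewrite linnerDl !linnerZl => ->; rewrite mulr0 add0r.
congr (- _); apply: linner_drop.
by rewrite linnerZl linnerC linner_crossr mulr0.
Qed.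

Lemma is_derive_T s : I s -> is_derive s 1 T (k s *: N s).
Proof.
move=> Is; apply: is_derive_eq (is_derive_tangentT Is) _; exact: accelE.
Qed.

(** The frame components of [N'] come from differentiating [<N, N> = 1] and [<T, N> = 0]; the one
    along [B] is [tau] by definition. *)
Lemma is_derive_N s : I s -> is_derive s 1 N (- k s *: T s + tau s *: B s).
Proof.
move=> Is; have dT := is_derive_T Is.
have dN : is_derive s 1 N ('D_1 N s).
  by apply: derivableP; have [] := derive_normalN Is.
have NN : linner ('D_1 N s) (N s) = 0.
  have : linner ('D_1 N s) (N s) + linner (N s) ('D_1 N s) = 0.
    apply: near_cst_is_derive0 (is_derive_linner dN dN).
    by near=> y; apply: linner_NN; near: y; exact: near_domain.
  by rewrite [in X in _ + X]linnerC; lra.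
have NT : linner ('D_1 N s) (T s) = - k s.
  have : linner (k s *: N s) (N s) + linner (T s) ('D_1 N s) = 0.
    apply: near_cst_is_derive0 (is_derive_linner dT dN).
    by near=> y; apply: linner_TN; near: y; exact: near_domain.
  by rewrite linnerZl linner_NN// [in X in _ + X]linnerC; lra.
apply: is_derive_eq dN _.
rewrite [LHS](frame_expand ('D_1 N s) (linner_TT Is) (linner_NN Is) (linner_TN Is)).
by rewrite NN NT scale0r addr0 -scaleNr /tau /torsion derive1E.
Unshelve. all: by end_near. Qed.

Lemma derivable_torsion s : I s -> derivable tau s 1.
Proof.
move=> Is; have dk := derivableP (derivable_curvatureV Is).
have dB := is_derive_lcross (is_derive_T Is) (is_derive_N Is).
have dl := is_derive_linner (is_derive_derive1n 3 Is) dB.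
have [d _] := is_deriveN (is_deriveM dk dl).
apply: near_eq_derivable d; near=> y; rewrite torsionE//.
by near: y; exact: near_domain.
Unshelve. all: by end_near. Qed.

Lemma curve_frenet_frame : frenet_frame I T N B k tau.
Proof.
exact: (FrenetFrame linner_TT linner_NN linner_TN (fun=> erefl) is_derive_T
  is_derive_N curvature_gt0 derivable_curvatureV derivable_torsion).
Qed.
Let F := curve_frenet_frame.

(** * The surface normal and the binormal *)

(** The normal at [(s, 1)] is [B s] up to a sign, and squaring makes that sign irrelevant. *)
Lemma constant_angle_binormal U theta : makes_constant_angle D x U theta ->
  forall s, I s -> linner (B s) U ^+ 2 = (llen U * coshR theta) ^+ 2.
Proof.
move=> [xi [[_ xiN] xiU]] s Is.
have Ds : D (s, 1) by split => //=; exact: ltr01.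
have [xi1 xi_perp] := xiN _ Ds; have [_ [_]] := xiU _ Ds.
rewrite (unit_timelike_llen xi1) mul1r.
move: (xi (s, 1)) xi1 xi_perp => n n1 n_perp nU.
have nT : linner (T s) n = 0.
  (* The two coordinate directions yield [T] and [T + k N] at [t = 1]. *)
  have := n_perp (0, 1); rewrite derive_developable_frame//= mulr0 mul0r.
  by rewrite scale0r addr0 add0r scale1r linnerC.
have nN : linner (N s) n = 0.
  apply: (mulfI (frame_k_neq0 F Is)); rewrite mulr0.
  have := n_perp (1, 0); rewrite derive_developable_frame//= addr0 scale1r !mul1r.
  by rewrite linnerDr linnerC nT add0r linnerZr linnerC.
have nB : linner (B s) n ^+ 2 = 1.
  move: n1; rewrite (frenet_norm F n Is) nT nN.
  by rewrite expr0n/= !add0r => /oppr_inj.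
move: nU; rewrite (frenet_expand F n Is) nT nN !scale0r !add0r -scaleNr linnerZl.
move=> /(congr1 (fun y => y ^+ 2)).
by rewrite exprMn !sqrrN nB mul1r.
Qed.

(** The normal field is [B], constant along rulings; the negative sign of [<B, U>] puts it in the
    cone of [U]. *)
Lemma binormal_constant_angle U theta : timelike U -> 0 <= theta ->
  (forall s, I s -> linner (B s) U = - (llen U * coshR theta)) ->
  makes_constant_angle D x U theta.
Proof.
move=> U0 theta0 BU; exists (fun p => B p.1); split; last first.
  move=> -[s t] [/= Is t0]; have B1 := frame_BB F Is; split.
    split => //; first by rewrite /timelike B1 oppr_lt0 ltr01.
    by rewrite BU// oppr_lt0 mulr_gt0 ?coshR_gt0 ?timelike_llen_gt0.
  by split => //=; rewrite BU// (unit_timelike_llen B1) mul1r.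
split.
  apply: continuous_in_subspaceT => -[s t] /set_mem[/= Is t0].
  have [/derivable1_diffP dB _] := frame_dB F Is.
  apply: (@continuous_comp _ _ _ fst B); first exact: cvg_fst.
  exact: differentiable_continuous.
move=> -[s t] [/= Is t0]; split; first exact: (frame_BB F).
move=> v; rewrite derive_developable_frame// linnerDr.
rewrite (linnerZr _ (T s)) (linnerZr _ (N s)) (frame_BT F) (frame_BN F).
by rewrite !mulr0 addr0.
Qed.

(** * The direction and angle formulas in terms of [r = tau / k] *)

Section ConstantRatio.
Variables (s r : R).
Hypotheses (Is : I s) (tauE : tau s = r * k s).

Let ratio_sqrt : Num.sqrt (k s ^+ 2 - tau s ^+ 2) = k s * Num.sqrt (1 - r ^+ 2).
Proof.
have -> : k s ^+ 2 - tau s ^+ 2 = k s ^+ 2 * (1 - r ^+ 2) by rewrite tauE; ring.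
by rewrite sqrtrM ?sqr_ge0// sqrtr_sqr gtr0_norm// curvature_gt0.
Qed.

(** The positive factor [k s] cancels, leaving [s] only in the vector [- r T + B], which is constant
    when [r] is. *)
Lemma angle_directionE :
  angle_direction g s = (Num.sqrt (1 - r ^+ 2))^-1 *: (- r *: T s + B s).
Proof.
rewrite /angle_direction ratio_sqrt -/(tau s) tauE.
have k0 := frame_k_neq0 F Is; move: k0; rewrite -/(k s) -/(T s) -/(B s).
move: (k s) (T s) (B s) (Num.sqrt _) => ks Ts Bs q k0.
have -> : - (r * ks) *: Ts + ks *: Bs = ks *: (- r *: Ts + Bs).
  by rewrite scalerDr scalerA mulrN mulrC.
by rewrite scalerA invfM mulrAC mulVf// mul1r.
Qed.

Lemma angle_coshE : angle_cosh g s = (Num.sqrt (1 - r ^+ 2))^-1.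
Proof.
rewrite /angle_cosh ratio_sqrt -/(k s).
by rewrite invfM mulrA divff ?mul1r// (frame_k_neq0 F).
Qed.

End ConstantRatio.

(** * Equivalence, existence and uniqueness of the direction *)

Hypotheses (I_itv : is_interval I) (I_neq0 : I !=set0).

Lemma constant_angle_helix U theta : timelike U ->
  makes_constant_angle D x U theta ->
  helix I g /\ forall s, I s -> tau s ^+ 2 < k s ^+ 2.
Proof.
move=> U0 /constant_angle_binormal BU.
exact: (constant_angle_frame_helix I_itv I_open F U0 BU).
Qed.

Lemma helix_direction : helix I g ->
  (forall s, I s -> tau s ^+ 2 < k s ^+ 2) ->
  exists (U : 'rV[R]_3) (theta : R),
    [/\ linner U U = -1, forall s, I s -> U = angle_direction g s,
        makes_constant_angle D x U theta
      & forall s, I s -> coshR theta = angle_cosh g s].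
Proof.
move=> [v [v0 [c Tv]]] tauk.
have [r tauE] := frame_helix_ratio_cst I_itv I_open F I_neq0 v0 Tv.
have [s0 Is0] := I_neq0.
have r1 : 0 < 1 - r ^+ 2.
  have := tauk _ Is0; rewrite tauE// exprMn gtr_pMl; first by rewrite subr_gt0.
  by rewrite exprn_gt0// curvature_gt0.
set q := Num.sqrt (1 - r ^+ 2).
have q0 : 0 < q by rewrite sqrtr_gt0.
have q2 : q ^+ 2 = 1 - r ^+ 2 by rewrite sqr_sqrtr// ltW.
(* This makes [q^-1] at least 1, hence a value of [coshR]. *)
have q1 : q <= 1 by rewrite -(ler_pXn2r (n := 2))// ?nnegrE ?(ltW q0)//
  q2 expr1n gerBl sqr_ge0.
have [theta theta0 thetaE] : exists2 t, 0 <= t & coshR t = q^-1.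
  by apply: coshR_surj; rewrite -invr1 lef_pV2 ?posrE.
pose U := q^-1 *: (- r *: T s0 + B s0).
have UE s : I s -> U = q^-1 *: (- r *: T s + B s).
  move=> Is; have W := frame_angle_vector_cst I_itv F tauE Is0 Is.
  exact: (congr1 ( *:%R q^-1) W).
have UU : linner U U = -1.
  rewrite /U linnerZl linnerZr (frame_angle_vector_norm F)//.
  have -> : r ^+ 2 - 1 = - q ^+ 2 by rewrite q2; ring.
  by field; rewrite gt_eqF.
exists U, theta; split => //.
- by move=> s Is; rewrite (angle_directionE Is (tauE _ Is)) (UE s).
- apply: binormal_constant_angle => //; first by rewrite /timelike UU ltrN10.
  move=> s Is; rewrite (unit_timelike_llen UU) mul1r thetaE (UE s)// linnerZr.
  rewrite linnerDr (linnerZr _ (T s)) (frame_BT F) (frame_BB F)//.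
  by rewrite mulr0 add0r mulrN1.
- by move=> s Is; rewrite (angle_coshE Is (tauE _ Is)).
Qed.

(** If [tau] vanished identically, [B] would be constant and every timelike vector would make a
    constant angle with it. The scalar [c] remains because [U] is not normalized and may lie in
    either timelike cone. *)
Lemma constant_angle_unique U theta : (exists2 s, I s & tau s != 0) ->
  timelike U -> makes_constant_angle D x U theta ->
  exists2 c : R, c != 0 &
    forall s, I s -> U = c *: angle_direction g s /\ coshR theta = angle_cosh g s.
Proof.
move=> [s0 Is0 tau0] U0 /constant_angle_binormal BU.
have [r [b [r1 b0 tauE UE]]] :=
  torsion_neq0_direction I_itv I_open F U0 BU Is0 tau0.
have {}r1 : 0 < 1 - r ^+ 2 by rewrite subr_gt0.
set q := Num.sqrt (1 - r ^+ 2).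
have q0 : 0 < q by rewrite sqrtr_gt0.
have q2 : q ^+ 2 = 1 - r ^+ 2 by rewrite sqr_sqrtr// ltW.
have BUb : linner (B s0) U = - b.
  rewrite (UE _ Is0) linnerZr linnerDr (linnerZr _ (T s0)).
  by rewrite (frame_BT F) (frame_BB F)// mulr0 add0r mulrN1.
have llenU : llen U ^+ 2 = (b * q) ^+ 2.
  rewrite linner_llen_sq// {1 2}(UE _ Is0) linnerZl linnerZr.
  by rewrite (frame_angle_vector_norm F)// exprMn q2; ring.
(* With [<B, U> = - b] and [|U| ^+ 2 = (b q) ^+ 2], the angle relation reads
   [b ^+ 2 = (b q coshR theta) ^+ 2]; [b] cancels, and positivity allows taking square roots. *)
have thetaE : coshR theta = q^-1.
  apply: (mulIf (lt0r_neq0 q0)); rewrite mulVf ?lt0r_neq0//.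
  apply/eqP; rewrite -(eqrXn2 (n := 2)) ?mulr_ge0 ?(ltW (coshR_gt0 _)) ?(ltW q0)//.
  have b2 : b ^+ 2 != 0 by rewrite sqrf_eq0.
  apply/eqP/(mulfI b2); have := BU _ Is0; rewrite BUb exprMn llenU => h.
  by rewrite expr1n mulr1 -[RHS]sqrrN h; ring.
exists (b * q); first by rewrite mulf_neq0// gt_eqF.
move=> s Is; rewrite (angle_directionE Is (tauE _ Is)).
rewrite (angle_coshE Is (tauE _ Is)); split; last exact: thetaE.
rewrite scalerA mulfK ?gt_eqF//; exact: UE.
Qed.

End SpacelikeDevelopable.

Theorem theorem4p1 (R : realType) (I : set R) (g : R -> 'rV[R]_3)
    (I_itv : is_interval I) (I_open : open I) (I_neq0 : I !=set0)
    (g_smooth : smooth_curve I g)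
    (g_unit : unit_speed_spacelike I g)
    (M_spacelike :
      spacelike_surface (developable_domain I) (tangent_developable g)) :
  (constant_angle_surface (developable_domain I) (tangent_developable g) <->
     helix I g /\ (forall s, I s -> torsion g s ^+ 2 < curvature g s ^+ 2))
  /\
  (constant_angle_surface (developable_domain I) (tangent_developable g) ->
     (* the vector U given by the formula is a fixed unit timelike vector, and
        M makes with it the angle given by the formula *)
     (exists (U : 'rV[R]_3) (theta : R),
        [/\ linner U U = -1,
            forall s, I s -> U = angle_direction g s,
            makes_constant_angle (developable_domain I) (tangent_developable g)
              U theta
          & forall s, I s -> coshR theta = angle_cosh g s])
     /\
     (* it is the only possible direction, unless M is planar *)
     ((exists2 s, I s & torsion g s != 0) ->
      forall (U : 'rV[R]_3) (theta : R), timelike U ->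
        makes_constant_angle (developable_domain I) (tangent_developable g)
          U theta ->
        exists2 c : R, c != 0 &
          forall s, I s ->
            U = c *: angle_direction g s /\ coshR theta = angle_cosh g s)).
Proof.
split; last first.
  move=> [U [theta [U0 Utheta]]]; split.
    have [hg tauk] :=
      constant_angle_helix I_open g_smooth g_unit M_spacelike I_itv U0 Utheta.
    exact: helix_direction.
  move=> tau0 {}U {}theta {}U0 {}Utheta.
  exact: constant_angle_unique tau0 U0 Utheta.
split=> [[U [theta [U0 Utheta]]]|[hg tauk]].
  exact: constant_angle_helix U0 Utheta.
have [U [theta [UU _ Utheta _]]] :=
  helix_direction I_open g_smooth g_unit M_spacelike I_itv I_neq0 hg tauk.
by exists U, theta; split => //; rewrite /timelike UU ltrN10.
Qed.
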